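(* Let $K$ be a field of characteristic $p>0$ and let $\Gamma\subseteq\mathbb{R}$ be an additive subgroup such that $\Gamma/p\Gamma$ is infinite. Let $M=K((t^{p\Gamma}))\cdot K(t^\Gamma)\subseteq K((t^\Gamma))$ be the compositum, with the norm induced from $K((t^\Gamma))$. Then: (i) there is a bounded sequence $(r_i)_{i\ge0}$ of elements of $\Gamma$ lying in pairwise distinct cosets of $p\Gamma$; (ii) $M$ is an algebraic extension of $K((t^{p\Gamma}))$ and consists exactly of those Hahn series in $K((t^\Gamma))$ whose exponents lie in finitely many cosets of $p\Gamma$ in $\Gamma$; (iii) the completion $\widehat M$ of $M$ is not spherically complete; (iv) there is no nonzero continuous $\widehat M$-linear map $\widehat M^{1/p}\to\widehat M$.
   Context: For a field $K$ and an additive subgroup $\Gamma\subseteq\mathbb{R}$: $K[t^\Gamma]$ is the ring of finite sums $\sum_{\gamma\in\Gamma}a_\gamma t^\gamma$ ($a_\gamma\in K$), $K(t^\Gamma)$ its fraction field, and $K((t^\Gamma))$ the Hahn series field of formal sums $\sum_{\gamma\in\Gamma}a_\gamma t^\gamma$ whose support $\{\gamma: a_\gamma\ne0\}$ is well-ordered, with the usual multiplication. These are valued by $\|\sum a_\gamma t^\gamma\|=\max_{a_\gamma\neq0}e^{-\gamma}$ (and $\|0\|=0$), a non-Archimedean absolute value; $K(t^\Gamma)\subseteq K((t^\Gamma))$ compatibly, and $K((t^{p\Gamma}))\subseteq K((t^\Gamma))$. A complete valued field is spherically complete if every decreasing sequence of closed disks has nonempty intersection. $\widehat M^{1/p}$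 carries the unique absolute value extending that of $\widehat M$; continuity refers to metric topologies. *)

(* Defs.v *)
From mathcomp Require Import all_boot all_order all_algebra.
From Stdlib Require Import Reals ClassicalEpsilon List.
Set Implicit Arguments. Unset Strict Implicit. Unset Printing Implicit Defensive.

Open Scope R_scope.

Section Hahn.
Variable K : fieldType.

Definition pmul_grp (p : nat) (G : R -> Prop) : R -> Prop :=
  fun x => exists g, G g /\ x = INR p * g.

Definition add_subgroup (G : R -> Prop) : Prop :=
  G R0 /\ (forall x y, G x -> G y -> G (x + y)) /\ (forall x, G x -> G (- x)).

Definition covered_by_cosets (H : R -> Prop) (l : list R) (A : R -> Prop) : Prop :=
  forall x, A x -> exists r, In r l /\ H (x - r).

Definition hahn (G : R -> Prop) (f : R -> K) : Prop :=
  (forall x, f x <> GRing.zero -> G x) /\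
  (forall S : R -> Prop, (forall x, S x -> f x <> GRing.zero) ->
     (exists x, S x) -> exists m, S m /\ forall x, S x -> m <= x).

Definition hpoly (G : R -> Prop) (f : R -> K) : Prop :=
  (forall x, f x <> GRing.zero -> G x) /\
  exists l : list R, forall x, f x <> GRing.zero -> In x l.

Definition hzero : R -> K := fun _ => GRing.zero.
Definition hone : R -> K :=
  fun x => if Req_EM_T x R0 then GRing.one K else GRing.zero.
Definition hadd (f g : R -> K) : R -> K := fun x => GRing.add (f x) (g x).
Definition hopp (f : R -> K) : R -> K := fun x => GRing.opp (f x).
Definition hsub (f g : R -> K) : R -> K := hadd f (hopp g).

(* Cauchy product: (f g)(x) = sum_{a+b=x} f a g b, a finite sum for Hahn series *)
Definition hmul (f g : R -> K) : R -> K := fun x =>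
  match excluded_middle_informative
          (exists l : list R, NoDup l /\
             forall a, (f a <> GRing.zero /\ g (x - a) <> GRing.zero) <-> In a l)
  with
  | left H =>
      let l := proj1_sig (constructive_indefinite_description _ H) in
      foldr GRing.add GRing.zero (map (fun a => GRing.mul (f a) (g (x - a))) l)
  | right _ => GRing.zero
  end.

Fixpoint hpow (f : R -> K) (n : nat) : R -> K :=
  match n with O => hone | S n => hmul f (hpow f n) end.

Definition hhorner (cs : list (R -> K)) (f : R -> K) : R -> K :=
  foldr (fun c acc => hadd c (hmul acc f)) hzero cs.

Definition hval (f : R -> K) : R :=
  epsilon (inhabits R0) (fun m => f m <> GRing.zero /\
                                 forall x, f x <> GRing.zero -> m <= x).

Definition hnorm (f : R -> K) : R :=
  if excluded_middle_informative (forall x, f x = GRing.zero) then R0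
  else exp (- hval f).

Definition hsubfield (G : R -> Prop) (S : (R -> K) -> Prop) : Prop :=
  (forall f, S f -> hahn G f) /\ S hzero /\ S hone /\
  (forall f g, S f -> S g -> S (hadd f g)) /\
  (forall f, S f -> S (hopp f)) /\
  (forall f g, S f -> S g -> S (hmul f g)) /\
  (forall f g, S f -> f <> hzero -> hahn G g -> hmul f g = hone -> S g).

Definition hrat (G : R -> Prop) (h : R -> K) : Prop :=
  exists f g, hpoly G f /\ hpoly G g /\ g <> hzero /\ hahn G h /\ hmul g h = f.

Definition compositum (p : nat) (G : R -> Prop) (f : R -> K) : Prop :=
  forall S, hsubfield G S ->
    (forall g, hahn (pmul_grp p G) g -> S g) ->
    (forall h, hrat G h -> S h) -> S f.

(* completion of M, realised as the closure of M in the complete field K((t^G)) *)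
Definition closure_in (G : R -> Prop) (A : (R -> K) -> Prop) (f : R -> K) : Prop :=
  hahn G f /\ forall eps, R0 < eps -> exists m, A m /\ hnorm (hsub f m) < eps.

Definition spherically_complete (A : (R -> K) -> Prop) : Prop :=
  forall (c : nat -> R -> K) (r : nat -> R),
    (forall n, A (c n)) -> (forall n, R0 <= r n) ->
    (forall n x, A x -> hnorm (hsub x (c (S n))) <= r (S n) ->
                        hnorm (hsub x (c n)) <= r n) ->
    exists x, A x /\ forall n, hnorm (hsub x (c n)) <= r n.

(* A^{1/p} is modelled via Frobenius: the element x^{1/p} (x in A) is
   represented by x itself; addition is that of A, the A-scalar action is
   a . x^{1/p} = (a^p x)^{1/p}, and the extended absolute value is
   || x^{1/p} || = ||x||^{1/p}.  A continuous A-linear map A^{1/p} -> A is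
   thus a map L on A with the properties below. *)
Definition cont_linear_root_map (p : nat) (A : (R -> K) -> Prop)
    (L : (R -> K) -> (R -> K)) : Prop :=
  (forall x, A x -> A (L x)) /\
  (forall x y, A x -> A y -> L (hadd x y) = hadd (L x) (L y)) /\
  (forall a x, A a -> A x -> L (hmul (hpow a p) x) = hmul a (L x)) /\
  (forall x, A x -> forall eps, R0 < eps -> exists delta, R0 < delta /\
     forall y, A y -> Rpower (hnorm (hsub y x)) (/ INR p) < delta ->
               hnorm (hsub (L y) (L x)) < eps).

End Hahn.

(* Main.v *)
Require Import Defs.
From Stdlib Require Import Znat.
From HB Require Import structures.
From mathcomp Require Import all_boot all_order all_algebra.
From mathcomp Require boolp.
From Stdlib Require Import Reals ClassicalEpsilon List Lra Lia.
Set Implicit Arguments. Unset Strict Implicit. Unset Printing Implicit Defensive.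
Import GRing.Theory.
Open Scope R_scope.
Delimit Scope ring_scope with A.

(** For every Hahn series u over G the power u^p has its exponents in pG. Hence
    u is a root of X^p - u^p, and division by u amounts to division by u^p, which
    respects the decomposition of a series along the cosets of pG; this identifies
    M with the series whose exponents lie in finitely many cosets.

    As G/pG is infinite, pG is dense in R, so there is a strictly increasing
    sequence s_n in [0, 1] of pairwise incongruent elements of G. An element of the
    completion of M has only finitely many cosets among its exponents below any
    bound, so no such element is nonzero at infinitely many s_n. Thus the partial
    sums of the t^{s_n} have no pseudo-limit in the completion.

    For a continuous linear map L and x in the completion, y |-> L (y^p x) is
    defined on the whole of K((t^G)), where every pseudo-convergent sequence has a
    pseudo-limit. If it is nonzero, a sequence that nearly realises its operator
    norm has a pseudo-limit whose image is nonzero at every s_n. *)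

(** * Finite sets of reals *)

HB.instance Definition _ := boolp.gen_eqMixin R.

Lemma InP (T : eqType) (x : T) (l : list T) : In x l <-> x \in l.
Proof.
elim: l => [|y l IH] //=; rewrite inE; split.
- by case=> [->|/IH ->]; rewrite ?eqxx ?orbT.
- by case/orP=> [/eqP ->|/IH]; [left|right].
Qed.

Lemma NoDup_uniq (T : eqType) (l : list T) : NoDup l -> uniq l.
Proof.
by elim: l => [|y l IH] //= /NoDup_cons_iff [nyl /IH ->]; rewrite andbT; apply/negP => /InP.
Qed.

Definition finite_set (U : R -> Prop) := exists l : list R, forall a, U a -> In a l.

Lemma finite_set_enum (U : R -> Prop) : finite_set U ->
  exists l : list R, NoDup l /\ forall a, U a <-> In a l.
Proof.
case=> l hl.
exists (nodup Req_EM_T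
  (List.filter (fun a => if excluded_middle_informative (U a) then true else false) l)).
split; first exact: NoDup_nodup.
move=> a; rewrite nodup_In filter_In; case: excluded_middle_informative => Ua; split=> //.
- by move=> _; split; first exact: hl.
- by case.
Qed.

(** * Well-ordered sets of reals *)

Definition wo (S : R -> Prop) := forall T : R -> Prop, (forall x, T x -> S x) ->
  (exists x, T x) -> exists m, T m /\ forall x, T x -> m <= x.

Lemma wo_sub (S T : R -> Prop) : (forall x, T x -> S x) -> wo S -> wo T.
Proof. by move=> sTS woS V sVT; apply: woS => x /sVT /sTS. Qed.

Lemma wo_union (S T : R -> Prop) : wo S -> wo T -> wo (fun x => S x \/ T x).
Proof.
move=> woS woT V sV [v Vv].
case: (classic (exists x, V x /\ S x)) => hS; last first.
  apply: woT; last by exists v.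
  by move=> x Vx; case: (sV x Vx) => // Sx; case: hS; exists x.
case: (classic (exists x, V x /\ T x)) => hT; last first.
  apply: woS; last by exists v.
  by move=> x Vx; case: (sV x Vx) => // Tx; case: hT; exists x.
have [|m [[Vm _] mmin]] := woS (fun x => V x /\ S x) _ hS; first by move=> x [].
have [|n [[Vn _] nmin]] := woT (fun x => V x /\ T x) _ hT; first by move=> x [].
case: (Rle_dec m n) => mn; [exists m | exists n]; split=> // x Vx;
  case: (sV x Vx) => [Sx|Tx].
- exact: mmin.
- by have := nmin x (conj Vx Tx); lra.
- by have := mmin x (conj Vx Sx); lra.
- exact: nmin.
Qed.

Lemma wo_singleton a : wo (fun x => x = a).
Proof.
move=> T sT [x Tx]; exists x; split=> // y Ty.
by rewrite (sT _ Tx) (sT _ Ty); lra.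
Qed.

Lemma wo_finite S : finite_set S -> wo S.
Proof.
case=> l sSl; apply: wo_sub sSl _; elim: l => [|a l IH]; first by move=> T sT [x /sT].
by apply: wo_sub (wo_union (@wo_singleton a) IH) => x /= [->|]; [left|right].
Qed.

(** Take the largest element of U below which U is finite. If it were not the maximum of U, the next
    element of U would have the same property. *)
Lemma finite_of_min_max (U : R -> Prop) : wo U -> wo (fun x => U (- x)) -> finite_set U.
Proof.
move=> woU woN.
pose V a := U a /\ finite_set (fun x => U x /\ x <= a).
case: (classic (exists x, U x)) => [neU|eU]; last first.
  by exists nil => a Ua; case: eU; exists a.
have [//|m [Um mmin]] := woU U _ neU.
have Vm : V m.
  split=> //; exists (m :: nil) => a [Ua am]; left.
  by have := mmin a Ua; lra.
(* The least v with [V (- v)] gives the largest element of V, namely - v. *)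
have [||v [[Uv [l hl]] vmax]] := woN (fun x => V (- x)).
- by move=> x [].
- by exists (- m); rewrite Ropp_involutive.
case: (classic (exists x, U x /\ - v < x)) => [ex|nex]; last first.
  exists l => a Ua; apply: hl; split=> //.
  by apply: Rnot_lt_le => va; case: nex; exists a.
have [|u [[Uu vu] umin]] := woU (fun x => U x /\ - v < x) _ ex; first by move=> x [].
have : v <= - u; last by lra.
apply: vmax; rewrite Ropp_involutive; split=> //; exists (u :: l) => a [Ua au] /=.
case: (Rle_dec a (- v)) => av; first by right; apply: hl.
by left; have := umin a (conj Ua (Rnot_le_lt _ _ av)); lra.
Qed.

(** The map a |-> x - a reverses the order, so S bounds descent in the fibre and T bounds ascent. *)
Lemma wo_fiber_finite (S T : R -> Prop) x : wo S -> wo T ->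
  finite_set (fun a => S a /\ T (x - a)).
Proof.
move=> woS woT; apply: finite_of_min_max; first by apply: wo_sub woS => a [].
move=> V sV [v Vv].
have [||m [Vm mmin]] := woT (fun b => V (b - x)).
- by move=> b /sV [_]; rewrite (_ : x - - (b - x) = b); last ring.
- by exists (v + x); rewrite (_ : v + x - x = v); last ring.
exists (m - x); split=> // y Vy.
have : m <= y + x; last by lra.
by apply: mmin; rewrite (_ : y + x - x = y); last ring.
Qed.

(* If W has no least element, pick in W an element a + b with b least; every
   smaller element of W then has its S-component below a, and one descends in S. *)
Lemma wo_sumset (S T : R -> Prop) : wo S -> wo T ->
  wo (fun x => exists a, S a /\ T (x - a)).
Proof.
move=> woS woT.
pose bad (P W : R -> Prop) := (exists x, W x) /\
  (~ exists m, W m /\ forall x, W x -> m <= x) /\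
  forall x, W x -> exists a, (S a /\ P a) /\ T (x - a).
have step P W : bad P W -> exists a, S a /\ P a /\ exists W', bad (fun x => x < a) W'.
  case=> [[w Ww] [nomin sW]].
  have [||b [[a [[Sa Pa] [Tb Wab]]] bmin]] :=
    woT (fun b => exists a, (S a /\ P a) /\ T b /\ W (a + b)).
  - by move=> b [a [_ []]].
  - have [a [Sa Ta]] := sW w Ww; exists (w - a), a; split=> //; split=> //.
    by rewrite (_ : a + (w - a) = w); last ring.
  exists a; split=> //; split=> //; exists (fun x => W x /\ x < a + b); split.
    apply: NNPP => h; apply: nomin; exists (a + b); split=> // x Wx.
    by apply: Rnot_lt_le => xab; apply: h; exists x.
  split.
    case=> m [[Wm mab] mmin]; apply: nomin; exists m; split=> // x Wx.
    case: (Rlt_dec x (a + b)) => h; first exact: mmin.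
    lra.
  move=> x [Wx xab]; have [c [[Sc Pc] Tc]] := sW x Wx.
  exists c; split=> //; split=> //.
  have : b <= x - c; last lra.
  apply: bmin; exists c; split=> //; split=> //.
  by rewrite (_ : c + (x - c) = x); last ring.
have nobad a : S a -> ~ exists W, bad (fun x => x < a) W.
  move=> Sa [W badW].
  have [||m [[Sm [W' badW']] mmin]] := woS (fun a => S a /\ exists W, bad (fun x => x < a) W).
  - by move=> x [].
  - by exists a; split=> //; exists W.
  have [c [Sc [cm badc]]] := step _ _ badW'.
  by have := mmin c (conj Sc badc); lra.
move=> W sW neW; apply: NNPP => nomin.
have [|a [Sa [_ badW]]] := step (fun _ => True) W.
  split=> //; split=> // x Wx; have [a [Sa Ta]] := sW x Wx; by exists a.
exact: nobad Sa badW.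
Qed.

(** * The ring of Hahn series with real exponents *)

Section HahnRing.
Variable K : fieldType.
Implicit Types (f g h : R -> K) (x a b : R).

Definition supp f : R -> Prop := fun x => f x <> 0%A.

Lemma supp_dec f x : f x = 0%A \/ supp f x.
Proof. by case: (eqVneq (f x) 0%A) => [->|/eqP]; [left|right]. Qed.

Lemma supp_hadd f g x : supp (hadd f g) x -> supp f x \/ supp g x.
Proof.
rewrite /supp /hadd; case: (supp_dec f x) => [->|]; last by left.
by rewrite add0r; right.
Qed.

Lemma supp_hopp f x : supp (hopp f) x -> supp f x.
Proof. by rewrite /supp /hopp => h e; apply: h; rewrite e oppr0. Qed.

Lemma hmulE f g x (l : list R) : uniq l ->
  (forall a, supp f a -> supp g (x - a) -> a \in l) ->
  hmul f g x = (\sum_(a <- l) f a * g (x - a)%R)%A.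
Proof.
move=> ul hl; rewrite /hmul; case: excluded_middle_informative => [H|nH]; last first.
  case: nH; have [|l' [nl' hl']] := @finite_set_enum (fun a => supp f a /\ supp g (x - a)).
    by exists l => a [fa ga]; apply/InP; apply: hl.
  by exists l'.
case: constructive_indefinite_description => /= l' [/NoDup_uniq ul' hl'].
rewrite -[foldr _ _ _]/(foldr _ _ [seq (f a * g (x - a)%R)%A | a <- l']) foldrE big_map.
rewrite [RHS](bigID (mem l')) /= [X in _ = (_ + X)%A]big1 ?addr0; last first.
  move=> a anl'; case: (supp_dec f a) => [->|fa]; first by rewrite mul0r.
  case: (supp_dec g (x - a)) => [->|ga]; first by rewrite mulr0.
  by case/negP: anl'; apply/InP/hl'.
rewrite -[RHS]big_filter; apply: perm_big; apply: uniq_perm => //; first exact: filter_uniq.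
move=> a; rewrite mem_filter; apply/idP/andP => [al'|[]//]; split=> //.
by move/InP/hl': al' => [fa ga]; apply: hl.
Qed.

Lemma hmul_supp f g x : supp (hmul f g) x -> exists a, supp f a /\ supp g (x - a).
Proof.
move=> fgx; apply: NNPP => h; apply: fgx.
by rewrite (@hmulE _ _ _ [::]) ?big_nil // => a fa ga; case: h; exists a.
Qed.

Lemma fiber_enum f g x : wo (supp f) -> wo (supp g) ->
  exists2 l : list R, uniq l & forall a, supp f a -> supp g (x - a) -> a \in l.
Proof.
move=> wf wg; have [l [/NoDup_uniq ul hl]] := finite_set_enum (wo_fiber_finite x wf wg).
by exists l => // a fa ga; apply/InP/hl.
Qed.

Lemma RsubKC x a : x - (x - a) = a.
Proof. ring. Qed.

Lemma hmulC f g : wo (supp f) -> wo (supp g) -> hmul f g = hmul g f.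
Proof.
move=> wf wg; apply: boolp.funext => x.
have [l ul hl] := fiber_enum x wf wg.
have inj : injective (fun a => x - a) by move=> a b ?; lra.
rewrite (hmulE ul hl) (@hmulE _ _ _ [seq x - a | a <- l]) ?map_inj_uniq //.
  rewrite big_map; apply: eq_bigr => a _; rewrite mulrC.
  by rewrite RsubKC.
move=> b gb fb; apply/mapP; exists (x - b); last by rewrite RsubKC.
by apply: hl; rewrite ?RsubKC.
Qed.

Lemma hmulEr f g x (l : list R) : wo (supp f) -> wo (supp g) -> uniq l ->
  (forall b, supp g b -> supp f (x - b) -> b \in l) ->
  hmul f g x = (\sum_(b <- l) f (x - b)%R * g b)%A.
Proof.
move=> wf wg ul hl; rewrite hmulC // (hmulE ul hl).
by apply: eq_bigr => b _; rewrite mulrC.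
Qed.

Lemma wo_hzero : wo (supp (hzero K)).
Proof. by move=> T sT [x /sT]. Qed.

Lemma supp_hone x : supp (hone K) x -> x = 0.
Proof. by rewrite /supp /hone; case: Req_EM_T. Qed.

Lemma wo_hone : wo (supp (hone K)).
Proof. exact: wo_sub supp_hone (@wo_singleton 0). Qed.

Lemma wo_hadd f g : wo (supp f) -> wo (supp g) -> wo (supp (hadd f g)).
Proof. by move=> wf wg; apply: wo_sub (wo_union wf wg) => x /supp_hadd. Qed.

Lemma wo_hopp f : wo (supp f) -> wo (supp (hopp f)).
Proof. by apply: wo_sub => x /supp_hopp. Qed.

Lemma wo_hmul f g : wo (supp f) -> wo (supp g) -> wo (supp (hmul f g)).
Proof. by move=> wf wg; apply: wo_sub (wo_sumset wf wg) => x /hmul_supp. Qed.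

(** Both sides expand to the double sum of f a * g (x - a - e) * h e over the finite lists [lA] and
    [lE] of first and last exponents that can occur in a decomposition of x. *)
Lemma hmulA f g h : wo (supp f) -> wo (supp g) -> wo (supp h) ->
  hmul f (hmul g h) = hmul (hmul f g) h.
Proof.
move=> wf wg wh; apply: boolp.funext => x.
have [lA [/NoDup_uniq uA hA]] :=
  finite_set_enum (wo_fiber_finite x wf (wo_sumset wg wh)).
have [lE [/NoDup_uniq uE hE]] :=
  finite_set_enum (wo_fiber_finite x wh (wo_sumset wf wg)).
rewrite (@hmulE _ _ _ lA) //; last first.
  by move=> a fa /hmul_supp gha; apply/InP/hA.
rewrite (@hmulEr _ _ _ lE) //; last first.
- by move=> e he /hmul_supp fge; apply/InP/hE.
- exact: wo_hmul.
rewrite (@eq_big_seq _ _ _ _ _ _ (fun a => \sum_(e <- lE) f a * g (x - a - e)%R * h e)%A).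
  rewrite exchange_big; apply: eq_big_seq => e /InP/hE [he _].
  rewrite (@hmulE _ _ _ lA) //; last first.
    move=> a fa ga; apply/InP/hA; split=> //.
    by exists (x - e - a); split=> //; rewrite (_ : x - a - (x - e - a) = e) //; ring.
  rewrite mulr_suml; apply: eq_bigr => a _.
  by rewrite (_ : (x - a - e = x - e - a)%R) //; ring.
move=> a /InP/hA [fa _].
rewrite (@hmulEr _ _ _ lE) //.
  by rewrite mulr_sumr; apply: eq_bigr => e _; rewrite mulrA.
move=> e he ge; apply/InP/hE; split=> //; exists a; split=> //.
by rewrite (_ : x - e - a = x - a - e) //; ring.
Qed.

Lemma hmulDl f g h : wo (supp f) -> wo (supp g) -> wo (supp h) ->
  hmul (hadd f g) h = hadd (hmul f h) (hmul g h).
Proof.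
move=> wf wg wh; apply: boolp.funext => x.
have [l1 u1 hl1] := fiber_enum x wf wh.
have [l2 u2 hl2] := fiber_enum x wg wh.
have ul : uniq (undup (l1 ++ l2)) by apply: undup_uniq.
rewrite /hadd !(hmulE ul) -?big_split.
- by apply: eq_bigr => a _; rewrite mulrDl.
- by move=> a ga ha; rewrite mem_undup mem_cat hl2 ?orbT.
- by move=> a ga ha; rewrite mem_undup mem_cat hl1.
- move=> a /supp_hadd [fa|ga] ha; rewrite mem_undup mem_cat.
  + by rewrite hl1.
  + by rewrite (hl2 a) ?orbT.
Qed.

Lemma hmul1f f : hmul (hone K) f = f.
Proof.
apply: boolp.funext => x; rewrite (@hmulE _ _ _ [:: 0]) //.
  rewrite big_seq1 /hone; case: (Req_EM_T 0 R0) => [e|]; last by case.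
  by rewrite mul1r Rminus_0_r.
by move=> a /supp_hone -> _; rewrite inE.
Qed.

(** The exponents range over all of R, and membership in G or pG stays a separate predicate. A
    single commutative ring then contains all the series involved. *)
Record hser := Hser { hcoef :> R -> K; hcoefP : wo (supp hcoef) }.
Arguments hcoefP : clear implicits.

Lemma hser_eq (u v : hser) : (forall x, u x = v x) -> u = v.
Proof.
case: u v => [f wf] [g wg] /= /boolp.funext efg.
by case: _ / efg wg => wg; rewrite (boolp.Prop_irrelevance wf wg).
Qed.

HB.instance Definition _ := boolp.gen_eqMixin hser.
HB.instance Definition _ := boolp.gen_choiceMixin hser.

Definition ser_zero := Hser wo_hzero.
Definition ser_one := Hser wo_hone.
Definition ser_add (u v : hser) := Hser (wo_hadd (hcoefP u) (hcoefP v)).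
Definition ser_opp (u : hser) := Hser (wo_hopp (hcoefP u)).
Definition ser_mul (u v : hser) := Hser (wo_hmul (hcoefP u) (hcoefP v)).

Lemma ser_addA : associative ser_add.
Proof. by move=> u v w; apply: hser_eq => x; rewrite /= /hadd addrA. Qed.
Lemma ser_addC : commutative ser_add.
Proof. by move=> u v; apply: hser_eq => x; rewrite /= /hadd addrC. Qed.
Lemma ser_add0 : left_id ser_zero ser_add.
Proof. by move=> u; apply: hser_eq => x; rewrite /= /hadd add0r. Qed.
Lemma ser_addN : left_inverse ser_zero ser_opp ser_add.
Proof. by move=> u; apply: hser_eq => x; rewrite /= /hadd /hopp addNr. Qed.

HB.instance Definition _ := GRing.isZmodule.Build hser ser_addA ser_addC ser_add0 ser_addN.

Lemma ser_mulA : associative ser_mul.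
Proof. by move=> [f wf] [g wg] [h wh]; apply: hser_eq => x; rewrite /= hmulA. Qed.
Lemma ser_mulC : commutative ser_mul.
Proof. by move=> [f wf] [g wg]; apply: hser_eq => x; rewrite /= hmulC. Qed.
Lemma ser_mul1 : left_id ser_one ser_mul.
Proof. by move=> u; apply: hser_eq => x; rewrite /= hmul1f. Qed.
Lemma ser_mulDl : left_distributive ser_mul ser_add.
Proof. by move=> [f wf] [g wg] [h wh]; apply: hser_eq => x; rewrite /= hmulDl. Qed.
Lemma ser_one_neq0 : ser_one != ser_zero.
Proof.
apply/eqP => /(congr1 (fun u : hser => u 0)) /=; rewrite /hone /hzero.
by case: Req_EM_T => // _ /eqP; rewrite oner_eq0.
Qed.

HB.instance Definition _ := GRing.Zmodule_isComNzRing.Build hser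
  ser_mulA ser_mulC ser_mul1 ser_mulDl ser_one_neq0.

Implicit Types (u v w : hser).

Lemma serE0 x : (0%A : hser) x = 0%A. Proof. by []. Qed.
Lemma serED u v x : (u + v)%A x = (u x + v x)%A. Proof. by []. Qed.
Lemma serEB u v x : (u - v)%A x = (u x - v x)%A. Proof. by []. Qed.

Lemma serE_sum (I : Type) (r : list I) (P : pred I) (F : I -> hser) x :
  (\sum_(i <- r | P i) F i)%A x = (\sum_(i <- r | P i) F i x)%A.
Proof. by elim/big_rec2: _ => // i y z _ <-; rewrite serED. Qed.

Lemma serX u n : hcoef (u ^+ n)%A = hpow u n.
Proof. by elim: n => [|n IH] //; rewrite exprS /= IH. Qed.

Lemma supp_add u v x : supp (u + v)%A x -> supp u x \/ supp v x.
Proof. exact: supp_hadd. Qed.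

Lemma supp_opp u x : supp (- u)%A x -> supp u x.
Proof. exact: supp_hopp. Qed.

Lemma supp_one x : supp (1 : hser)%A x -> x = 0.
Proof. exact: supp_hone. Qed.

Lemma supp_mul u v x : supp (u * v)%A x -> exists a, supp u a /\ supp v (x - a).
Proof. exact: hmul_supp. Qed.

Lemma mkser_subproof f : wo (supp (if excluded_middle_informative (wo (supp f)) then f else hzero K)).
Proof. by case: excluded_middle_informative => [//|nw]; apply: wo_hzero. Qed.

(** A total map into the ring, with default value zero, so that values of maps on plain functions
    can be taken as ring elements before their support is known to be well-ordered. *)
Definition mkser f : hser := Hser (@mkser_subproof f).

Lemma mkserE f : wo (supp f) -> hcoef (mkser f) = f.
Proof. by move=> wf /=; case: excluded_middle_informative. Qed.

Lemma hcoefK u : mkser u = u.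
Proof. by apply: hser_eq => x; rewrite mkserE //; apply: hcoefP. Qed.

Definition restr_fun (P : R -> Prop) f : R -> K :=
  fun x => if excluded_middle_informative (P x) then f x else 0%A.

Lemma supp_restr_fun P f x : supp (restr_fun P f) x -> P x /\ supp f x.
Proof. by rewrite /supp /restr_fun; case: excluded_middle_informative. Qed.

Lemma restr_subproof P u : wo (supp (restr_fun P u)).
Proof. by apply: wo_sub (hcoefP u) => x ux; case: (supp_restr_fun ux). Qed.

Definition restr P u : hser := Hser (@restr_subproof P u).

Lemma supp_restr P u x : supp (restr P u) x -> P x /\ supp u x.
Proof. exact: supp_restr_fun. Qed.

Lemma restr_dom P u x : supp (restr P u) x -> P x.
Proof. by move=> h; case: (supp_restr h). Qed.

Lemma restr_supp P u x : supp (restr P u) x -> supp u x.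
Proof. by move=> h; case: (supp_restr h). Qed.

Lemma restrT (P : R -> Prop) u x : P x -> restr P u x = u x.
Proof. by rewrite /= /restr_fun; case: excluded_middle_informative. Qed.

Lemma restrF (P : R -> Prop) u x : ~ P x -> restr P u x = 0%A.
Proof. by rewrite /= /restr_fun; case: excluded_middle_informative. Qed.

Lemma restr_split P u : u = (restr P u + restr (fun x => ~ P x) u)%A.
Proof.
apply: hser_eq => x; rewrite serED; case: (classic (P x)) => Px.
- by rewrite restrT // restrF ?addr0 // => /(_ Px).
- by rewrite restrF // restrT ?add0r.
Qed.

Definition mono_fun (c : K) a : R -> K := fun x => if Req_EM_T x a then c else 0%A.

Lemma supp_mono_fun c a x : supp (mono_fun c a) x -> x = a.
Proof. by rewrite /supp /mono_fun; case: Req_EM_T. Qed.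

Lemma mono_subproof c a : wo (supp (mono_fun c a)).
Proof. by apply: wo_sub (@wo_singleton a) => x /supp_mono_fun. Qed.

Definition mono c a : hser := Hser (@mono_subproof c a).

Lemma supp_mono c a x : supp (mono c a) x -> x = a.
Proof. exact: supp_mono_fun. Qed.

Lemma monoE c a : mono c a a = c.
Proof. by rewrite /= /mono_fun; case: Req_EM_T. Qed.

Lemma mulmonoE c a u x : (mono c a * u)%A x = (c * u (x - a)%R)%A.
Proof.
rewrite [LHS](@hmulE _ _ _ [:: a]) // ?big_seq1; first by rewrite monoE.
by move=> b /supp_mono_fun -> _; rewrite inE.
Qed.

Lemma monoD c a d b : (mono c a * mono d b)%A = mono (c * d)%A (a + b).
Proof.
apply: hser_eq => x; rewrite mulmonoE /= /mono_fun.
by do 2!case: Req_EM_T => ?; rewrite ?mulr0 //; exfalso; lra.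
Qed.

Lemma mono10 : mono 1%A 0 = 1%A.
Proof. exact: hser_eq. Qed.

Definition lead u m := supp u m /\ forall x, supp u x -> m <= x.

Lemma lead_ex u : u <> 0%A -> exists m, lead u m.
Proof.
move=> u0; have [//||m [um mmin]] := hcoefP u (supp u); last by exists m.
apply: NNPP => h; apply: u0; apply: hser_eq => x.
by case: (supp_dec u x) => // ux; case: h; exists x.
Qed.

Lemma lead_neq0 u m : lead u m -> u <> 0%A.
Proof. by case=> um _ u0; apply: um; rewrite u0. Qed.

(** Only the pair (m, n) contributes to the exponent m + n, and K has no zero divisors. *)
Lemma leadM u v m n : lead u m -> lead v n -> lead (u * v)%A (m + n).
Proof.
move=> [um mmin] [vn nmin]; split; last first.
  by move=> x /supp_mul [a [/mmin ? /nmin ?]]; lra.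
rewrite /supp [hcoef _ _](@hmulE _ _ _ [:: m]) //.
  rewrite big_seq1 (_ : (m + n - m = n)%R); last ring.
  by apply/eqP; rewrite mulf_neq0 //; apply/eqP.
move=> a ua va; rewrite inE; apply/eqP.
by have := mmin _ ua; have := nmin _ va; lra.
Qed.

Lemma leadX u m n : lead u m -> lead (u ^+ n)%A (INR n * m).
Proof.
move=> um; elim: n => [|n IH].
  rewrite Rmult_0_l expr0; split; last by move=> x /supp_hone ->; lra.
  rewrite /supp /= /hone; case: Req_EM_T => [e|]; last by case.
  by apply/eqP; rewrite oner_eq0.
rewrite exprS S_INR (_ : (INR n + 1) * m = m + INR n * m); last ring.
exact: leadM.
Qed.

Lemma ser_mulf_eq0 u v : (u * v)%A = 0%A -> u <> 0%A -> v = 0%A.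
Proof.
move=> uv0 /lead_ex [m um]; apply: NNPP => /lead_ex [n vn].
exact: lead_neq0 (leadM um vn) uv0.
Qed.

End HahnRing.
Arguments hcoefP {K} _.

(** * Frobenius *)

Fixpoint iter_sumset (S : R -> Prop) (n : nat) : R -> Prop :=
  match n with
  | O => fun x => x = 0
  | S n => fun x => exists a, S a /\ iter_sumset S n (x - a)
  end.

Lemma wo_iter_sumset S n : wo S -> wo (iter_sumset S n).
Proof.
by move=> woS; elim: n => [|n IH]; [exact: wo_singleton | exact: wo_sumset].
Qed.

Section Frobenius.
Variables (K : fieldType) (p : nat).
Hypotheses (hp : prime p) (hchar : p \in GRing.pchar K).
Implicit Types (u v w : hser K).

(** The set S may exceed the support: [frob_supp] takes for S the support of a series and for u one
    of its restrictions. *)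
Lemma supp_pow (S : R -> Prop) u n x : (forall y, supp u y -> S y) ->
  supp (u ^+ n)%A x -> iter_sumset S n x.
Proof.
move=> uS; elim: n x => [|n IH] x; first by rewrite expr0 => /supp_one.
by rewrite exprS => /supp_mul [a [ua va]]; exists a; split; [exact: uS|exact: IH].
Qed.

Lemma hser_pchar : p \in GRing.pchar (hser K).
Proof.
rewrite inE hp /=; apply/eqP; apply: hser_eq => x.
have natE n : (n%:R : hser K)%A x = (hone K x *+ n)%A.
  by elim: n => [|n IH]; rewrite ?mulr0n // !mulrS serED IH.
by rewrite natE (mulrn_pchar hchar).
Qed.

Lemma frobD u v : ((u + v) ^+ p = u ^+ p + v ^+ p)%A.
Proof. by rewrite exprDn_pchar // pnatE // hser_pchar. Qed.

Lemma monoX (c : K) a n : (mono c a ^+ n)%A = mono (c ^+ n)%A (INR n * a).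
Proof.
elim: n => [|n IH]; first by rewrite !expr0 Rmult_0_l mono10.
by rewrite exprS IH monoD -exprS; congr mono; rewrite S_INR; ring.
Qed.

(** Induction on l: split off the monomial at a, use that Frobenius is additive, and that the p-th
    power of c t^a is c^p t^(pa). *)
Lemma frob_supp_finite (l : list R) u x : (forall y, supp u y -> In y l) ->
  supp (u ^+ p)%A x -> exists a, supp u a /\ x = INR p * a.
Proof.
have p0 := prime_gt0 hp.
elim: l u x => [|a l IH] u x ul.
  rewrite (_ : u = 0%A); first by rewrite expr0n eqn0Ngt p0 => /(_ erefl).
  by apply: hser_eq => y; case: (supp_dec u y) => // /ul.
rewrite {1}(restr_split (fun y => y = a) u) frobD => /supp_add [].
  rewrite (_ : restr _ u = mono (u a) a); last first.
    by apply: hser_eq => y; rewrite /= /mono_fun /restr_fun;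
      case: excluded_middle_informative => ya; case: Req_EM_T => //= _; rewrite ya.
  rewrite monoX => h; exists a; split; last exact: supp_mono h.
  move=> ua0; apply: h.
  by rewrite ua0 expr0n eqn0Ngt p0 /= /mono_fun; case: Req_EM_T.
case/IH=> [y h|b [/restr_supp ub ->]].
  by have [ya uy] := supp_restr h; case: (ul y uy) => // /esym.
by exists b.
Qed.

(* Only finitely many exponents a of u enter the coefficient of u^p at x, so
   that additivity of Frobenius reduces the claim to finite sums. *)
Lemma frob_supp (G : R -> Prop) u x : (forall y, supp u y -> G y) ->
  supp (u ^+ p)%A x -> pmul_grp p G x.
Proof.
move=> uG; have [l hl] := wo_fiber_finite x (hcoefP u) (@wo_iter_sumset _ p.-1 (hcoefP u)).
rewrite (restr_split (fun y => In y l) u) frobD => /supp_add [|].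
  case/(@frob_supp_finite l) => [y /restr_dom //|a [/restr_supp ua ->]].
  by exists a; split=> //; apply: uG.
(* If the part of u off l had a p-th power nonzero at x, then x = a + (x - a) with a off l and x - a
   a sum of p - 1 exponents of u, against the choice of l. *)
rewrite -(prednK (prime_gt0 hp)) exprS => /supp_mul [a [h va]]; have [nal ua] := supp_restr h.
case: nal; apply: hl; split=> //; apply: supp_pow va => y.
exact: restr_supp.
Qed.

End Frobenius.

(** * The compositum as the series with finitely many cosets *)

Lemma subgroup_natmul (G : R -> Prop) n g : add_subgroup G -> G g -> G (INR n * g).
Proof.
move=> [G0 [GD GN]] Gg; elim: n => [|n IH]; first by rewrite Rmult_0_l.
by rewrite S_INR Rmult_plus_distr_r Rmult_1_l; apply: GD.
Qed.

Section Cosets.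
Variable H : R -> Prop.
Hypothesis hH : add_subgroup H.

Lemma subgroupB x y : H x -> H y -> H (x - y).
Proof. by case: hH => _ [HD HN] Hx Hy; apply: HD => //; apply: HN. Qed.

Lemma covered_sub l (A B : R -> Prop) : (forall x, A x -> B x) ->
  covered_by_cosets H l B -> covered_by_cosets H l A.
Proof. by move=> sAB cB x /sAB /cB. Qed.

Lemma covered_union l1 l2 (A B : R -> Prop) :
  covered_by_cosets H l1 A -> covered_by_cosets H l2 B ->
  covered_by_cosets H (l1 ++ l2) (fun x => A x \/ B x).
Proof.
move=> c1 c2 x [/c1 [r [rl Hr]] | /c2 [r [rl Hr]]]; exists r; split=> //;
  apply: in_or_app; by [left|right].
Qed.

Lemma covered_sum l1 l2 (A B : R -> Prop) :
  covered_by_cosets H l1 A -> covered_by_cosets H l2 B ->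
  covered_by_cosets H (List.map (fun q => q.1 + q.2) (list_prod l1 l2))
    (fun x => exists a, A a /\ B (x - a)).
Proof.
move=> c1 c2 x [a [/c1 [r [rl Hr]] /c2 [s [sl Hs]]]]; exists (r + s); split.
  by apply/in_map_iff; exists (r, s); split=> //; apply: in_prod.
rewrite (_ : x - (r + s) = (a - r) + (x - a - s)); last ring.
by case: hH => _ [HD _]; apply: HD.
Qed.

End Cosets.

Section Compositum.
Variables (K : fieldType) (p : nat).
Hypotheses (hp : prime p) (hchar : p \in GRing.pchar K).
Variable G : R -> Prop.
Hypothesis hG : add_subgroup G.
Local Notation H := (pmul_grp p G).
Implicit Types (u v w : hser K).

Lemma pmul_subgroup : add_subgroup H.
Proof.
case: hG => G0 [GD GN]; split; first by exists R0; split=> //; rewrite Rmult_0_r.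
split.
  by move=> _ _ [x [Gx ->]] [y [Gy ->]]; exists (x + y); split; [exact: GD|ring].
by move=> _ [x [Gx ->]]; exists (- x); split; [exact: GN|ring].
Qed.
Local Notation hH := pmul_subgroup.

Lemma pmul_sub x : H x -> G x.
Proof. by case=> g [Gg ->]; apply: subgroup_natmul. Qed.

Definition exps_in u := forall x, supp u x -> G x.
Definition fin_cosets u := exps_in u /\ exists l, covered_by_cosets H l (supp u).

Lemma exps_in0 : exps_in 0%A.
Proof. by move=> x /(_ erefl). Qed.

Lemma exps_in1 : exps_in 1%A.
Proof. by move=> x /supp_one ->; case: hG. Qed.

Lemma exps_inD u v : exps_in u -> exps_in v -> exps_in (u + v)%A.
Proof. by move=> Gu Gv x /supp_add [/Gu|/Gv]. Qed.

Lemma exps_inN u : exps_in u -> exps_in (- u)%A.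
Proof. by move=> Gu x /supp_opp /Gu. Qed.

Lemma exps_inM u v : exps_in u -> exps_in v -> exps_in (u * v)%A.
Proof.
move=> Gu Gv x /supp_mul [a [/Gu Ga /Gv Gxa]]; case: hG => _ [GD _].
by rewrite (_ : x = a + (x - a)); [exact: GD | ring].
Qed.

Lemma exps_inX u n : exps_in u -> exps_in (u ^+ n)%A.
Proof.
by move=> Gu; elim: n => [|n IH]; [exact: exps_in1 | rewrite exprS; exact: exps_inM].
Qed.

Lemma exps_in_mono c a : G a -> exps_in (mono c a).
Proof. by move=> Ga x /supp_mono ->. Qed.

Lemma fin_cosets0 : fin_cosets 0%A.
Proof. by split; [exact: exps_in0 | exists nil => x /(_ erefl)]. Qed.

Lemma fin_cosets_mono c a : G a -> fin_cosets (mono c a).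
Proof.
move=> Ga; split; first exact: exps_in_mono.
exists (a :: nil) => x /supp_mono ->; exists a; split; first by left.
by rewrite Rminus_diag; case: hH.
Qed.

Lemma fin_cosets1 : fin_cosets 1%A.
Proof. by rewrite -mono10; apply: fin_cosets_mono; case: hG. Qed.

Lemma fin_cosetsD u v : fin_cosets u -> fin_cosets v -> fin_cosets (u + v)%A.
Proof.
move=> [Gu [l cu]] [Gv [m cv]]; split; first exact: exps_inD.
exists (l ++ m); apply: covered_sub (covered_union cu cv) => x.
exact: supp_add.
Qed.

Lemma fin_cosetsN u : fin_cosets u -> fin_cosets (- u)%A.
Proof.
move=> [Gu [l cu]]; split; first exact: exps_inN.
by exists l; apply: covered_sub cu => x; apply: supp_opp.
Qed.

Lemma fin_cosetsM u v : fin_cosets u -> fin_cosets v -> fin_cosets (u * v)%A.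
Proof.
move=> [Gu [l cu]] [Gv [m cv]]; split; first exact: exps_inM.
eexists; apply: covered_sub (covered_sum hH cu cv) => x.
exact: supp_mul.
Qed.

Lemma fin_cosetsX u n : fin_cosets u -> fin_cosets (u ^+ n)%A.
Proof.
by move=> Gu; elim: n => [|n IH]; [exact: fin_cosets1 | rewrite exprS; exact: fin_cosetsM].
Qed.

Lemma frob_exps u x : exps_in u -> supp (u ^+ p)%A x -> H x.
Proof. exact: frob_supp. Qed.

(* Multiplication by u^p preserves the decomposition of v along cosets of pG:
   the part of v outside the cosets met by u^p v is killed by u^p. *)
Lemma fin_cosets_div u v : fin_cosets u -> u <> 0%A -> exps_in v ->
  fin_cosets (u * v)%A -> fin_cosets v.
Proof.
move=> fu u0 Gv fuv.
have [_ [l cl]] : fin_cosets (u ^+ p * v)%A.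
  rewrite -(prednK (prime_gt0 hp)) exprSr -mulrA; apply: fin_cosetsM => //.
  exact: fin_cosetsX.
pose P x := exists r, In r l /\ H (x - r).
have PB x a : supp (u ^+ p)%A a -> P x <-> P (x - a).
  move=> ua; have Ha : H a by apply: frob_exps ua; case: fu.
  case: hH => _ [HD _]; split=> -[r [rl Hr]]; exists r; split=> //.
    by rewrite (_ : x - a - r = x - r - a); [apply: (subgroupB hH) | ring].
  by rewrite (_ : x - r = x - a - r + a); [apply: HD | ring].
have v2 : restr (fun x => ~ P x) v = 0%A.
  apply: (@ser_mulf_eq0 _ (u ^+ p)%A); last first.
    have [m um] := lead_ex u0; exact: lead_neq0 (leadX p um).
  apply: hser_eq => x; rewrite serE0.
  case: (supp_dec (u ^+ p * restr (fun x => ~ P x) v)%A x) => // sx.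
  have [a [ua /restr_dom nP]] := supp_mul sx.
  have nPx : ~ P x by move/(PB x a ua).
  (* At x outside P the part of v inside P contributes nothing, so the coefficient is that of u^p v,
     which vanishes off P. *)
  case: (supp_dec (u ^+ p * restr P v)%A x) => [e1|/supp_mul [b [ub /restr_dom Pb]]];
    last by case: nPx; apply/(PB x b ub).
  case: (supp_dec (u ^+ p * v)%A x) => [|/cl //].
  by rewrite {1}(restr_split P v) mulrDr serED e1 add0r.
split=> //; exists l => x; rewrite (restr_split P v) v2 addr0.
exact: restr_dom.
Qed.

Lemma hahnP (f : R -> K) : hahn G f <-> exists2 u : hser K, hcoef u = f & exps_in u.
Proof.
split=> [[Gf wf]|[u <- Gu]]; first by exists (Hser wf).
by split=> //; apply: hcoefP.
Qed.

Definition fin_cosets_fun (f : R -> K) := hahn G f /\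
  exists l : list R, covered_by_cosets H l (fun x => f x <> GRing.zero).

Lemma fin_cosets_funP f : fin_cosets_fun f <-> exists2 u : hser K, hcoef u = f & fin_cosets u.
Proof.
split=> [[/hahnP [u <- Gu] cu]|[u <- [Gu cu]]]; first by exists u.
by split=> //; apply/hahnP; exists u.
Qed.

Lemma subfield_fin_cosets : hsubfield G fin_cosets_fun.
Proof.
split; first by move=> f [].
split; first by apply/fin_cosets_funP; exists 0%A => //; apply: fin_cosets0.
split; first by apply/fin_cosets_funP; exists 1%A => //; apply: fin_cosets1.
split.
  move=> f g /fin_cosets_funP [u <- fu] /fin_cosets_funP [v <- fv].
  by apply/fin_cosets_funP; exists (u + v)%A => //; apply: fin_cosetsD.
split.
  move=> f /fin_cosets_funP [u <- fu].
  by apply/fin_cosets_funP; exists (- u)%A => //; apply: fin_cosetsN.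
split.
  move=> f g /fin_cosets_funP [u <- fu] /fin_cosets_funP [v <- fv].
  by apply/fin_cosets_funP; exists (u * v)%A => //; apply: fin_cosetsM.
move=> f g /fin_cosets_funP [u <- fu] u0 /hahnP [v <- Gv] uv1.
apply/fin_cosets_funP; exists v => //; apply: (fin_cosets_div fu) => //.
  by move=> ue; apply: u0; rewrite ue.
rewrite (_ : (u * v)%A = 1%A); first exact: fin_cosets1.
by apply: hser_eq => x; rewrite -[hcoef (u * v)%A]/(hmul u v) uv1.
Qed.

Lemma hpoly_fin_cosets (f : R -> K) : hpoly G f -> fin_cosets_fun f.
Proof.
move=> [Gf [l fl]]; split; last first.
  exists l => x /fl xl; exists x; split=> //.
  by rewrite Rminus_diag; case: hH.
by split=> //; apply: wo_finite; exists l.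
Qed.

(** Induction on the number of cosets: the part of u in one coset is t^a times a series over pG,
    where t^a lies in K(t^G). *)
Lemma fin_cosets_compositum u : fin_cosets u -> compositum p G u.
Proof.
move=> [Gu [l cu]] S [_ [S0 [_ [SD [_ [SM _]]]]]] SH Srat.
elim: l u Gu cu => [|r l IH] u Gu cu.
  rewrite (_ : hcoef u = hzero K) //; apply: boolp.funext => x.
  by case: (supp_dec u x) => // /cu [r []].
rewrite (restr_split (fun x => H (x - r)) u); apply: SD; last first.
  apply: IH => x h; have [nH ux] := supp_restr h; first exact: Gu.
  by have [s [[<- //|sl] Hs]] := cu x ux; exists s.
set v := restr _ u.
(* The listed representative r may lie outside G, so an exponent a of v is used in its place. *)
case: (classic (v = 0%A)) => [->//|/lead_ex [a [va _]]].
have [Har ua] : H (a - r) /\ supp u a by apply: supp_restr va.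
have Ga : G a by apply: Gu.
rewrite (_ : v = (mono 1 a * (mono 1 (- a)%R * v))%A); last first.
  by rewrite mulrA monoD mulr1 Rplus_opp_r mono10 mul1r.
apply: SM; last first.
  apply: SH; split; last exact: hcoefP.
  move=> x; rewrite mulmonoE mul1r => /restr_dom Hx.
  rewrite (_ : x = x - - a - r - (a - r)); last ring.
  exact: (subgroupB hH).
apply: Srat; exists (mono 1%A a), (hone K).
have poly1 b : G b -> hpoly G (mono (1%A : K) b).
  move=> Gb; split; first exact: exps_in_mono.
  by exists (b :: nil) => x /supp_mono ->; left.
split; first exact: poly1.
split; first by apply: (poly1 R0); case: hG.
split.
  move=> /(congr1 (fun f => f R0)); rewrite /hone /hzero.
  by case: Req_EM_T => // _ /eqP; rewrite oner_eq0.
split; last exact: hmul1f.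
by apply/hahnP; exists (mono 1%A a) => //; apply: exps_in_mono.
Qed.

(** The series with finitely many cosets form a subfield containing K((t^(pG))), and by
    [fin_cosets_div] also all quotients of polynomials; the compositum is the least such
    subfield. *)
Lemma compositumP (f : R -> K) : compositum p G f <-> fin_cosets_fun f.
Proof.
split=> [|/fin_cosets_funP [u <- fu]]; last exact: fin_cosets_compositum.
apply; first exact: subfield_fin_cosets.
  move=> g [Hg wg]; split; first by split=> // x /Hg /pmul_sub.
  exists (R0 :: nil) => x /Hg Hx; exists R0; split; first by left.
  by rewrite Rminus_0_r.
move=> h [f' [g [/hpoly_fin_cosets/fin_cosets_funP [u eu fu]]]].
move=> [/hpoly_fin_cosets/fin_cosets_funP [v ev fv] [g0 [/hahnP [w <- Gw] gw]]].
apply/fin_cosets_funP; exists w => //; apply: (fin_cosets_div fv) => //.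
  by move=> v0; apply: g0; rewrite -ev v0.
rewrite (_ : (v * w)%A = u) //; apply: hser_eq => x.
by rewrite eu -gw -ev.
Qed.

Lemma hahn_algebraic (f : R -> K) : hahn G f -> exists cs : list (R -> K),
  (forall c, In c cs -> hahn H c) /\ (exists c, In c cs /\ c <> hzero K) /\
  hhorner cs f = hzero K.
Proof.
move=> /hahnP [u <- Gu].
have p0 := prime_gt0 hp.
have hahn_of v : (forall x, supp v x -> H x) -> hahn H v.
  by move=> Hv; split=> //; apply: hcoefP.
(* The coefficients of X^p - u^p by increasing degree; the constant one has its exponents in pG by
   Frobenius. *)
exists (hcoef (- u ^+ p)%A :: app (repeat (hzero K) p.-1) (hone K :: nil)); split.
  move=> c [<-|/(@in_app_or _ _ _ _) [h|[<-|[]]]].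
  - by apply: hahn_of => x /supp_opp; apply: frob_exps.
  - by rewrite (repeat_spec _ _ _ h); apply: (hahn_of 0%A) => x /(_ erefl).
  - by apply: (hahn_of 1%A) => x /supp_one ->; case: hH.
split.
  exists (hone K); split; last first.
    move=> /(congr1 (fun f => f R0)); rewrite /hone /hzero.
    by case: Req_EM_T => // _ /eqP; rewrite oner_eq0.
  by right; apply: in_or_app; right; left.
have E n : hhorner (app (repeat (hzero K) n) (hone K :: nil)) u = hcoef (u ^+ n)%A.
  elim: n => [|n IH] /=.
    rewrite (_ : hmul (hzero K) u = hcoef (0 * u : hser K)%A) // mul0r.
    by apply: boolp.funext => x; rewrite /hadd addr0.
  rewrite IH (_ : hmul (u ^+ n)%A u = hcoef (u ^+ n.+1)%A) ?exprSr //.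
  by apply: boolp.funext => x; rewrite /hadd add0r.
rewrite [LHS]/= -/(hhorner _ _) E (_ : hmul (u ^+ p.-1)%A u = hcoef (u ^+ p)%A).
  by apply: boolp.funext => x; rewrite /hadd /hopp addNr.
by rewrite -{2}(prednK p0) exprSr.
Qed.

End Compositum.

(** * Density of pG and representatives of infinitely many cosets *)

Lemma floor_mul x T : 0 < T -> exists z, IZR z * T <= x < IZR z * T + T.
Proof.
move=> T0; have [h1 h2] := archimed (x / T); exists (up (x / T) - 1)%Z.
have xE : x = x / T * T by field; lra.
have := Rmult_lt_compat_r T _ _ T0 h1; have := Rmult_le_compat_r T _ _ (Rlt_le _ _ T0) h2.
by rewrite minus_IZR; split; lra.
Qed.

Lemma subgroup_intmul (G : R -> Prop) z g : add_subgroup G -> G g -> G (IZR z * g).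
Proof.
move=> hG Gg; case: (Z.le_gt_cases 0 z) => z0.
  by rewrite -(Z2Nat.id _ z0) -INR_IZR_INZ; apply: subgroup_natmul.
rewrite (_ : IZR z * g = - (IZR (- z) * g)); last by rewrite opp_IZR; ring.
case: (hG) => _ [_ GN]; apply: GN.
by rewrite -(Z2Nat.id (- z)); [rewrite -INR_IZR_INZ; apply: subgroup_natmul | lia].
Qed.

Section CosetSequence.
Variables (p : nat) (G : R -> Prop).
Hypotheses (hp : (0 < p)%nat) (hG : add_subgroup G).
Hypothesis hinf : ~ exists l : list R, covered_by_cosets (pmul_grp p G) l G.
Local Notation H := (pmul_grp p G).

Lemma INRp_gt0 : 0 < INR p.
Proof. by apply: lt_0_INR; apply/ltP. Qed.

(* If the positive elements of G were bounded below by e, then [0, T[ would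
   contain at most one element of G in each cell of length e, for T > 0 in pG. *)
Lemma small_elements e : 0 < e -> exists g, G g /\ 0 < g < e.
Proof.
move=> e0; apply: NNPP => nosmall; apply: hinf.
have [G0 [GD GN]] := hG.
have sep x y : G x -> G y -> x - y < e -> y - x < e -> x = y.
  move=> Gx Gy xy yx; case: (Rtotal_order x y) => [h|[//|h]].
  - by case: nosmall; exists (y - x); split; [exact: subgroupB | lra].
  - by case: nosmall; exists (x - y); split; [exact: subgroupB | lra].
case: (classic (exists g, G g /\ 0 < g)) => [[g [Gg g0]]|nopos]; last first.
  exists (R0 :: nil) => x Gx; exists R0; split; first by left.
  suff -> : x = 0 by rewrite Rminus_0_r; case: (pmul_subgroup p hG).
  case: (Rtotal_order x 0) => [h|[//|h]]; case: nopos; [exists (- x)|exists x].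
  - by split; [exact: GN | lra].
  - by split.
(* As T lies in pG, each x in G is congruent to its remainder y in [0, T[. Cells of length e cut
   this interval into finitely many pieces. *)
pose T := INR p * g.
have T0 : 0 < T by apply: Rmult_lt_0_compat => //; apply: INRp_gt0.
pose cell k y := G y /\ INR k * e <= y < INR k * e + e.
pose N := Z.to_nat (up (T / e)).
(* One representative per cell; for a cell without elements of G the listed real is arbitrary. *)
exists (List.map (fun k => epsilon (inhabits R0) (cell k)) (List.seq 0 N)) => x Gx.
have [z [zx xz]] := floor_mul x T0.
have HzT : H (IZR z * T).
  exists (IZR z * g); split; last by rewrite /T; ring.
  exact: subgroup_intmul.
have Gy : G (x - IZR z * T) by apply: subgroupB => //; apply: pmul_sub HzT.
set y := x - IZR z * T in Gy.
have [q [qy yq]] := floor_mul y e0.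
have y0 : 0 <= y by rewrite /y; lra.
have yT : y < T by rewrite /y; lra.
have q0 : (0 <= q)%Z.
  apply/Z.lt_succ_r; apply: lt_IZR; rewrite succ_IZR.
  by apply: (Rmult_lt_reg_r e) => //; lra.
have qN : (q < up (T / e))%Z.
  apply: lt_IZR; have [h _] := archimed (T / e).
  have TE : T = T / e * e by field; lra.
  by apply: Rle_lt_trans h; apply: (Rmult_le_reg_r e) => //; lra.
have celly : cell (Z.to_nat q) y by rewrite /cell INR_IZR_INZ Z2Nat.id.
exists (epsilon (inhabits R0) (cell (Z.to_nat q))); split.
  by apply/in_map_iff; exists (Z.to_nat q); split=> //; apply/in_seq; rewrite /N; lia.
have [Gw cw] := epsilon_spec (inhabits R0) (cell (Z.to_nat q)) (ex_intro _ y celly).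
have [_ cy] := celly.
set w := epsilon _ _ in Gw cw *.
have <- : y = w by apply: sep => //; lra.
by rewrite /y RsubKC.
Qed.

(** For g in G with 0 < g < (b - a) / p, the first multiple of pg beyond a still lies before b. *)
Lemma pmul_dense a b : a < b -> exists h, H h /\ a < h < b.
Proof.
move=> ab; have p0 := INRp_gt0.
have [|g [Gg [g0 gb]]] := @small_elements ((b - a) / INR p).
  by apply: Rdiv_lt_0_compat; lra.
have T0 : 0 < INR p * g by apply: Rmult_lt_0_compat.
have TE : (b - a) / INR p * INR p = b - a by field; lra.
have := Rmult_lt_compat_r _ _ _ p0 gb; rewrite TE => gb'.
have [z [za az]] := floor_mul a T0; exists (IZR z * (INR p * g) + INR p * g); split.
  by case: (pmul_subgroup p hG) => _ [HD _]; apply: HD;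
    [apply: subgroup_intmul; first exact: pmul_subgroup|]; exists g.
by split; lra.
Qed.

(** Some g in G avoids the cosets of l, as these do not cover G; density of pG moves it into ]a, b[
    within its coset. *)
Lemma new_coset (l : list R) a b : a < b ->
  exists g, G g /\ a < g < b /\ forall r, In r l -> ~ H (g - r).
Proof.
move=> ab; have [g [Gg ng]] : exists g, G g /\ forall r, In r l -> ~ H (g - r).
  apply: NNPP => h; apply: hinf; exists l => x Gx; apply: NNPP => nx; apply: h.
  by exists x; split=> // r rl Hr; apply: nx; exists r.
have [|h [Hh [ah hb]]] := @pmul_dense (a - g) (b - g); first lra.
exists (g + h); split; first by case: hG => _ [GD _]; apply: GD => //; apply: pmul_sub Hh.
split; first lra.
move=> r rl Hr; apply: (ng r rl).
by rewrite (_ : g - r = g + h - r - h); [apply: (subgroupB (pmul_subgroup p hG)) | ring].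
Qed.

Lemma increasing_coset_sequence : exists s : nat -> R,
  [/\ forall n, G (s n), forall n, 0 <= s n <= 1, forall n, s n < s (S n) &
      forall i j, i <> j -> ~ H (s i - s j)].
Proof.
(* The n-th term is chosen in ]b n, b (n + 1)[, which gives both the bounds and the monotonicity.
   The list [L n] below holds the earlier terms, whose cosets are avoided. *)
pose b n := 1 - / INR (S n).
have b_lt n : b n < b (S n).
  rewrite /b; have n0 : 0 < INR (S n) by apply: lt_0_INR; lia.
  have : / INR (S (S n)) < / INR (S n); last lra.
  by apply: Rinv_lt_contravar; [apply: Rmult_lt_0_compat => // |];
    rewrite (S_INR (S n)); lra.
pose next n l := epsilon (inhabits R0)
  (fun g => G g /\ b n < g < b (S n) /\ forall r, In r l -> ~ H (g - r)).
have nextP n l : G (next n l) /\ b n < next n l < b (S n) /\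
    forall r, In r l -> ~ H (next n l - r).
  exact: (epsilon_spec (inhabits R0) _ (new_coset l (b_lt n))).
pose L := fix L n := match n with O => nil | S n => next n (L n) :: L n end.
pose s n := next n (L n).
have sL i j : (i < j)%nat -> In (s i) (L j).
  elim: j => [|j IH] //; rewrite ltnS leq_eqVlt => /orP [/eqP ->|/IH]; first by left.
  by right.
have sn i j : (i < j)%nat -> ~ H (s j - s i).
  by move=> /sL; case: (nextP j (L j)) => _ [_]; apply.
exists s; split.
- by move=> n; case: (nextP n (L n)).
- move=> n; have [_ [[h1 h2] _]] := nextP n (L n).
  have iv k : 0 < / INR (S k) <= 1.
    have k0 : 0 < INR (S k) by apply: lt_0_INR; lia.
    split; first exact: Rinv_0_lt_compat.
    rewrite -Rinv_1; apply: Rinv_le_contravar; first lra.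
    by rewrite S_INR; have := pos_INR k; lra.
  by have := iv n; have := iv (S n); rewrite /b -/(s n) in h1 h2; lra.
- move=> n; have [_ [[_ h1] _]] := nextP n (L n).
  by have [_ [[h2 _] _]] := nextP (S n) (L (S n)); rewrite /s; lra.
- move=> i j ij; case: (ltngtP i j) => // h; last exact: sn.
  case: (pmul_subgroup p hG) => _ [_ HN] Hij; apply: (sn _ _ h).
  by rewrite -Ropp_minus_distr; apply: HN.
Qed.

(** Pigeonhole: a representative in l chosen for each term would map 1 + [length l] indices
    injectively into l. *)
Lemma distinct_cosets_not_covered (s : nat -> R) (l : list R) :
  (forall i j, i <> j -> ~ H (s i - s j)) ->
  ~ (forall n, exists r, In r l /\ H (s n - r)).
Proof.
move=> sd cov.
pose r n := epsilon (inhabits R0) (fun r => In r l /\ H (s n - r)).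
have rP n : In (r n) l /\ H (s n - r n) by apply: epsilon_spec (cov n).
have : (length (List.map r (List.seq 0 (S (length l)))) <= length l)%coq_nat.
  apply: NoDup_incl_length; last by move=> x /in_map_iff [n [<- _]]; case: (rP n).
  apply: NoDup_map_NoDup_ForallPairs (seq_NoDup _ _) => i j _ _ rij.
  apply: NNPP => /sd; apply.
  have [_ Hi] := rP i; have [_ Hj] := rP j; rewrite rij in Hi.
  rewrite (_ : s i - s j = s i - r j - (s j - r j)); last ring.
  by apply: subgroupB => //; apply: pmul_subgroup.
by rewrite length_map length_seq; lia.
Qed.

End CosetSequence.

(** * Norm and completion *)

Section Norm.
Variable K : fieldType.
Implicit Types (u v w : hser K).

Definition exps_ge u m := forall x, supp u x -> m <= x.

Lemma exps_ge_ex u : exists m, exps_ge u m.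
Proof.
case: (classic (u = 0%A)) => [->|/lead_ex [m [_ um]]]; last by exists m.
by exists 0 => x /(_ erefl).
Qed.

Lemma exps_geM u v m n : exps_ge u m -> exps_ge v n -> exps_ge (u * v)%A (m + n).
Proof. by move=> um vn x /supp_mul [a [/um ? /vn ?]]; lra. Qed.

Lemma exps_geX u m n : exps_ge u m -> exps_ge (u ^+ n)%A (INR n * m).
Proof.
move=> um; elim: n => [|n IH]; first by rewrite Rmult_0_l => x /supp_one ->; lra.
rewrite exprS S_INR (_ : (INR n + 1) * m = m + INR n * m); last ring.
exact: exps_geM.
Qed.

Lemma exps_ge_mono (c : K) a : exps_ge (mono c a) a.
Proof. by move=> x /supp_mono ->; lra. Qed.

Lemma hnorm0 : hnorm (0%A : hser K) = 0.
Proof. by rewrite /hnorm; case: excluded_middle_informative => [//|[]]. Qed.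

Lemma hnorm_lead u m : lead u m -> hnorm u = exp (- m).
Proof.
move=> [um mmin]; rewrite /hnorm; case: excluded_middle_informative => [/(_ m)//|nu].
rewrite /hval.
have [hu hmin] := epsilon_spec (inhabits R0)
  (fun m => u m <> GRing.zero /\ forall x, u x <> GRing.zero -> m <= x)
  (ex_intro _ m (conj um mmin)).
rewrite /=; congr (exp (- _)).
by apply: Rle_antisym; [exact: hmin | exact: mmin].
Qed.

(** Together with [hnorm_lt], this replaces norms by bounds on exponents, the zero series
    included. *)
Lemma hnorm_le u B : hnorm u <= exp (- B) <-> forall x, supp u x -> B <= x.
Proof.
case: (classic (u = 0%A)) => [->|/lead_ex [m um]].
  rewrite hnorm0; split=> _; first by move=> x /(_ erefl).
  exact/Rlt_le/exp_pos.
rewrite (hnorm_lead um); case: um => um mmin; split=> [h x /mmin|/(_ m um) [h| ->]].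
- have : ~ exp (- B) < exp (- m) by lra.
  by move=> h1; case: (Rle_lt_dec B m) => h2; [lra | case: h1; apply: exp_increasing; lra].
- by apply/Rlt_le/exp_increasing; lra.
- lra.
Qed.

Lemma hnorm_lt u B : hnorm u < exp (- B) <-> forall x, supp u x -> B < x.
Proof.
case: (classic (u = 0%A)) => [->|/lead_ex [m um]].
  rewrite hnorm0; split=> _; first by move=> x /(_ erefl).
  exact: exp_pos.
rewrite (hnorm_lead um); case: um => um mmin; split=> [/exp_lt_inv h x /mmin|/(_ m um) h].
- lra.
- by apply: exp_increasing; lra.
Qed.

Lemma supp_sum (e : nat -> hser K) n x : supp (\sum_(0 <= i < n) e i)%A x ->
  exists i, (i < n)%nat /\ supp (e i) x.
Proof.
elim: n => [|n IH]; first by rewrite big_nil => /(_ erefl).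
rewrite big_nat_recr //= => /supp_add [/IH [i [lt_in si]]|sn]; last by exists n.
by exists i; rewrite ltnS ltnW.
Qed.

Lemma sum_eval (e : nat -> hser K) n k x : (k < n)%nat ->
  (forall i, i <> k -> e i x = 0%A) -> (\sum_(0 <= i < n) e i)%A x = e k x.
Proof.
move=> kn e0; rewrite serE_sum (bigD1_seq k) ?iota_uniq ?mem_index_iota //=.
by rewrite big1 ?addr0 // => i /eqP /e0.
Qed.

(** A least exponent is sought among those below a given one, so only initial segments of f
    matter. *)
Lemma wo_local (f : R -> K) :
  (forall y, supp f y -> exists u, forall x, x <= y -> f x = u x) -> wo (supp f).
Proof.
move=> loc T sT [y Ty]; have [u fu] := loc y (sT y Ty).
have [||m [[Tm my] mmin]] := hcoefP u (fun x => T x /\ x <= y).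
- by move=> x [/sT fx xy]; rewrite /supp -fu.
- by exists y; split=> //; lra.
exists m; split=> // x Tx; case: (Rle_lt_dec x y) => xy; last lra.
exact: mmin.
Qed.

(** The coefficient of the partial sums at x is stationary once x <= t n, and this is the value
    taken. If t is bounded, the limit is set to zero beyond all t n, so its exponents already occur
    in partial sums. *)
Lemma pseudo_limit (t : nat -> R) (e : nat -> hser K) : (forall n, t n <= t (S n)) ->
  (forall n x, supp (e n) x -> t n < x) ->
  exists y : hser K, (forall n x, x <= t n -> y x = (\sum_(0 <= i < n) e i)%A x) /\
    (forall x, supp y x -> exists n, x <= t n).
Proof.
move=> tmono et.
have stab n k x : x <= t n ->
    (\sum_(0 <= i < n + k) e i)%A x = (\sum_(0 <= i < n) e i)%A x.
  move=> xn; have xk : x <= t (n + k)%nat.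
    by elim: k => [|k IH]; rewrite ?addn0 // addnS; have := tmono (n + k)%nat; lra.
  elim: k xk => [|k IH] xk; first by rewrite addn0.
  have tk : t n <= t (n + k)%nat.
    elim: k {IH xk} => [|k IH]; rewrite ?addn0 ?addnS; first lra.
    by have := tmono (n + k)%nat; lra.
  rewrite addnS big_nat_recr // serED IH; last lra.
  by case: (supp_dec (e (n + k)%nat) x) => [->|/et]; [rewrite addr0 | lra].
pose N x := epsilon (inhabits O) (fun n => x <= t n).
pose f x := if excluded_middle_informative (exists n, x <= t n)
  then (\sum_(0 <= i < N x) e i)%A x else 0%A.
have fE n x : x <= t n -> f x = (\sum_(0 <= i < n) e i)%A x.
  move=> xn; rewrite /f; case: excluded_middle_informative => [h|[]]; last by exists n.
  have xN : x <= t (N x) := epsilon_spec (inhabits O) _ h.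
  case: (leqP n (N x)) => [/subnKC <-|/ltnW /subnKC <-]; first exact: stab.
  by rewrite stab.
have fsupp x : supp f x -> exists n, x <= t n.
  by rewrite /supp /f; case: excluded_middle_informative.
have wf : wo (supp f).
  apply: wo_local => y /fsupp [n yn]; exists (\sum_(0 <= i < n) e i)%A => x xy.
  by apply: fE; lra.
by exists (Hser wf).
Qed.

End Norm.

Section Completion.
Variables (K : fieldType) (p : nat).
Hypotheses (hp : prime p) (hchar : p \in GRing.pchar K).
Variable G : R -> Prop.
Hypothesis hG : add_subgroup G.
Hypothesis hinf : ~ exists l : list R, covered_by_cosets (pmul_grp p G) l G.
Local Notation H := (pmul_grp p G).
Local Notation hH := (pmul_subgroup p hG).
Local Notation Mhat := (closure_in G (@compositum K p G)).
Implicit Types (u v w y z : hser K).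

Definition locally_fin_cosets u := exps_in G u /\
  forall B, exists l, covered_by_cosets H l (fun x => supp u x /\ x <= B).

Lemma fin_cosets_locally u : fin_cosets p G u -> locally_fin_cosets u.
Proof.
by move=> [Gu [l cu]]; split=> // B; exists l; apply: covered_sub cu => x [].
Qed.

(** An approximation closer than e^(-B) has the same coefficients up to B. Conversely, truncating u
    at - ln eps gives an element of M at distance less than eps. *)
Lemma closureP (f : R -> K) : Mhat f <-> exists2 u : hser K, hcoef u = f & locally_fin_cosets u.
Proof.
split=> [[/hahnP [u <- Gu] approx]|[u <- [Gu lu]]].
  exists u => //; split=> // B.
  have [m [/(compositumP hp hchar hG) /fin_cosets_funP [v <- [_ [l cv]]]]] := approx _ (exp_pos (- B)).
  rewrite -[hsub u v]/(hcoef (u - v)%A) => /hnorm_lt uvB.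
  exists l; apply: covered_sub cv => x [ux xB] vx; apply: ux.
  have : (u - v)%A x = 0%A by case: (supp_dec (u - v)%A x) => // /uvB; lra.
  by rewrite serEB vx subr0.
split; first by apply/hahnP; exists u.
move=> eps eps0; have [l cl] := lu (- ln eps).
pose v := restr (fun x => x <= - ln eps) u; exists v; split.
  apply/(compositumP hp hchar hG)/fin_cosets_funP; exists v => //; split.
    by move=> x /restr_supp /Gu.
  by exists l; apply: covered_sub cl => x h; have [] := supp_restr h.
rewrite -[hsub u v]/(hcoef (u - v)%A) -[X in _ < X](exp_ln _ eps0) -[X in exp X]Ropp_involutive.
apply/hnorm_lt => x sx; apply: Rnot_le_lt => xB; apply: sx.
by rewrite serEB restrT // subrr.
Qed.

Lemma locally_fin_cosetsM u v :
  locally_fin_cosets u -> locally_fin_cosets v -> locally_fin_cosets (u * v)%A.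
Proof.
move=> [Gu lu] [Gv lv]; split; first exact: exps_inM.
move=> B; have [m um] := exps_ge_ex u; have [n vn] := exps_ge_ex v.
have [l cl] := lu (B - n); have [k ck] := lv (B - m).
eexists; apply: covered_sub (covered_sum hH cl ck) => x [/supp_mul [a [ua va]] xB].
by exists a; have := um _ ua; have := vn _ va; do !split=> //; lra.
Qed.

Lemma locally_fin_cosetsX u n : locally_fin_cosets u -> locally_fin_cosets (u ^+ n)%A.
Proof.
move=> lu; elim: n => [|n IH]; first exact/fin_cosets_locally/fin_cosets1.
by rewrite exprS; apply: locally_fin_cosetsM.
Qed.

(** All exponents lie in the single coset pG. Hence y^p X stays in the completion for every Hahn
    series y over G. *)
Lemma frob_fin_cosets u : exps_in G u -> fin_cosets p G (u ^+ p)%A.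
Proof.
move=> Gu; split; first exact: exps_inX.
exists (R0 :: nil) => x /(frob_exps hp hchar Gu) Hx; exists R0.
by split; [left | rewrite Rminus_0_r].
Qed.

(** * Obstructions from a bounded sequence of incongruent exponents *)

Section Sequence.
Variable s : nat -> R.
Hypotheses (Gs : forall n, G (s n)) (s01 : forall n, 0 <= s n <= 1).
Hypotheses (s_lt : forall n, s n < s (S n)) (s_dist : forall i j, i <> j -> ~ H (s i - s j)).

(** These exponents are at most 1 and would fall into finitely many cosets. The shift of index
    matches [bounded_linear_eq0], where the n-th correction acts at s_(n+1). *)
Lemma locally_fin_cosets_gap u : locally_fin_cosets u -> ~ forall n, supp u (s (S n)).
Proof.
move=> [_ lu] us; have [l cl] := lu 1.
apply: (@distinct_cosets_not_covered p G hG (fun n => s (S n)) l) => [i j ij|n].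
  by apply: s_dist => -[].
by apply: cl; split=> //; case: (s01 (S n)).
Qed.

Lemma not_spherically_complete : ~ spherically_complete Mhat.
Proof.
move=> sph; pose c n : hser K := (\sum_(0 <= i < n) mono 1 (s i))%A.
have cS n : c (S n) = (c n + mono 1 (s n))%A by rewrite /c big_nat_recr.
have [|||x [/closureP [u <- lu] uc]] := sph (fun n => hcoef (c n)) (fun n => exp (- s n)).
- move=> n; apply/closureP; exists (c n) => //; apply: fin_cosets_locally.
  elim: n => [|n IH]; first by rewrite /c big_nil; apply: fin_cosets0.
  by rewrite cS; apply: fin_cosetsD => //; apply: fin_cosets_mono.
- by move=> n; apply/Rlt_le/exp_pos.
- move=> n f /closureP [u <- _].
  rewrite -[hsub _ (c (S n))]/(hcoef (u - c (S n))%A) -[hsub _ _]/(hcoef (u - c n)%A).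
  move=> /hnorm_le un; apply/hnorm_le => x.
  have -> : (u - c n = (u - c (S n)) + mono 1 (s n))%A by rewrite cS opprD addrA subrK.
  by case/supp_add=> [/un|/supp_mono ->]; have := s_lt n; lra.
apply: (locally_fin_cosets_gap lu) => n.
(* The disk of index n + 2 fixes all coefficients at exponents below s_(n+2), in particular the
   coefficient 1 at s_(n+1). *)
move: (uc (S (S n))); rewrite -[hsub _ _]/(hcoef (u - c (S (S n)))%A) => /hnorm_le un.
have : (u - c (S (S n)))%A (s (S n)) = 0%A.
  case: (supp_dec (u - c (S (S n)))%A (s (S n))) => // /un.
  by have := s_lt (S n); lra.
rewrite serEB => /eqP; rewrite subr_eq0 => /eqP; rewrite /supp => ->.
rewrite (@sum_eval _ _ _ (S n)) //.
  by rewrite monoE; apply/eqP; rewrite oner_eq0.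
move=> i ni; case: (supp_dec (mono (1%A : K) (s i)) (s (S n))) => // /supp_mono e.
case: (s_dist ni); rewrite e Rminus_diag; by case: hH.
Qed.

(* Let k be the supremum of v(y) - v(Phi y). One finds e_n with v(e_n) > k + s_n
   such that Phi e_n is supported in the coset of s_{n+1} and nonzero at s_{n+1};
   then Phi of a pseudo-limit of the sums of the e_i is nonzero at every s_{n+1}. *)
Lemma bounded_linear_eq0 (Phi : hser K -> hser K) :
  (forall y, exps_in G y -> locally_fin_cosets (Phi y)) ->
  (forall y z, exps_in G y -> exps_in G z -> Phi (y + z)%A = (Phi y + Phi z)%A) ->
  (forall a y, locally_fin_cosets a -> exps_in G y -> Phi (a * y)%A = (a * Phi y)%A) ->
  (exists k, forall y m n, exps_in G y -> exps_ge y m -> supp (Phi y) n -> m - n <= k) ->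
  forall y, exps_in G y -> Phi y = 0%A.
Proof.
move=> PhiM PhiD PhiZ [k0 bnd] y0 Gy0; apply: NNPP => Phi_n0.
pose E r := exists y m n, exps_in G y /\ exps_ge y m /\ supp (Phi y) n /\ r = m - n.
have [||k [kub klub]] := completeness E.
- by exists k0 => _ [y [m [n [Gy [ym [yn ->]]]]]]; apply: bnd ym yn.
- have [m ym] := exps_ge_ex y0; have [n [yn _]] := lead_ex Phi_n0.
  by exists (m - n), y0, m, n.
have gap y m n : exps_in G y -> exps_ge y m -> supp (Phi y) n -> m - n <= k.
  by move=> Gy ym yn; apply: kub; exists y, m, n.
have near d : 0 < d -> exists y m n,
    exps_in G y /\ exps_ge y m /\ lead (Phi y) n /\ k - d < m - n.
  move=> d0; apply: NNPP => nex; have : k <= k - d; last lra.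
  apply: klub => _ [y [m [n [Gy [ym [yn ->]]]]]]; apply: Rnot_lt_le => kd; apply: nex.
  have [|n' [yn' n'min]] := @lead_ex _ (Phi y); first by move=> e; apply: yn; rewrite e.
  by exists y, m, n'; do !split=> //; have := n'min n yn; lra.
have step n : exists e, exps_in G e /\ (forall x, supp e x -> k + s n < x) /\
    supp (Phi e) (s (S n)) /\ forall x, supp (Phi e) x -> H (x - s (S n)).
  have [|u [m [q [Gu [um [wq mq]]]]]] := near (s (S n) - s n); first by have := s_lt n; lra.
  pose w := Phi u; have lw : locally_fin_cosets w by apply: PhiM.
  have Gw : exps_in G w by case: lw.
  have wpq : lead (w ^+ p)%A (INR p * q) := leadX p wq.
  have Hpq : H (INR p * q) by exists q; split=> //; apply: Gw; case: wq.
  (* The series w^p has least exponent pq and all its exponents in pG; the factor t^c moves pq to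
     s_(n+1). As w^p = w^(p-1) Phi u, linearity realises t^c w^p as Phi (a u). *)
  pose c := s (S n) - INR p * q.
  have Gc : G c by apply: (subgroupB hG) => //; apply: pmul_sub Hpq.
  pose a : hser K := (mono 1 c * w ^+ p.-1)%A.
  have la : locally_fin_cosets a.
    apply: locally_fin_cosetsM; last exact: locally_fin_cosetsX.
    exact/fin_cosets_locally/fin_cosets_mono.
  have Phie : Phi (a * u)%A = (mono 1 c * w ^+ p)%A.
    by rewrite PhiZ // -/w /a -mulrA -exprSr prednK ?prime_gt0.
  exists (a * u)%A; split; first by apply: exps_inM => //; case: la.
  split.
    have wge : exps_ge w q by case: wq.
    (* The exponents of a u are at least c + (p - 1) q + m = s_(n+1) + m - q, which exceeds k + s_n
       by the choice of u. *)
    move=> x /(exps_geM (exps_geM (exps_ge_mono (c := 1%A) (a := c)) (exps_geX (n := p.-1) wge)) um).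
    have pE : INR p = INR p.-1 + 1 by rewrite -S_INR prednK ?prime_gt0.
    rewrite /c pE; lra.
  rewrite Phie; split.
    rewrite /supp mulmonoE mul1r (_ : s (S n) - c = INR p * q); last by rewrite /c; ring.
    by case: wpq.
  move=> x; rewrite /supp mulmonoE mul1r => /(frob_exps hp hchar Gw) Hx.
  rewrite (_ : x - s (S n) = x - c - INR p * q); last by rewrite /c; ring.
  exact: (subgroupB hH).
pose e n := epsilon (inhabits (0%A : hser K)) (fun e => exps_in G e /\
  (forall x, supp e x -> k + s n < x) /\
  supp (Phi e) (s (S n)) /\ forall x, supp (Phi e) x -> H (x - s (S n))).
have eP n := epsilon_spec (inhabits (0%A : hser K)) _ (step n); rewrite -/(e _) in eP.
have [||y [yE ys]] := @pseudo_limit K (fun n => k + s n) e.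
- by move=> n; have := s_lt n; lra.
- by move=> n x; case: (eP n) => _ [h _]; apply: h.
pose S_ n : hser K := (\sum_(0 <= i < n) e i)%A.
have GS n : exps_in G (S_ n).
  by move=> x /supp_sum [i [_]]; case: (eP i) => Ge _; apply: Ge.
have PhiS n : Phi (S_ n) = (\sum_(0 <= i < n) Phi (e i))%A.
  elim: n => [|n IH].
    have l0 : locally_fin_cosets 0%A := fin_cosets_locally (@fin_cosets0 K p G).
    by have := PhiZ _ _ l0 (proj1 l0); rewrite /S_ !big_nil !mul0r.
  rewrite /S_ !big_nat_recr // PhiD -/(S_ n) ?IH //.
  by case: (eP n).
have Gy : exps_in G y.
  by move=> x yx; have [n xn] := ys x yx; apply: (GS n); rewrite /supp -yE.
apply: (locally_fin_cosets_gap (PhiM y Gy)) => n.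
(* The exponents of z are at least k + s_(n+2), so by the choice of k those of Phi z are at least
   s_(n+2). At s_(n+1) only the partial sum counts, and there only e_n, since the other Phi e_i live
   in other cosets. *)
pose z : hser K := (y - S_ (S (S n)))%A.
have Gz : exps_in G z by apply: exps_inD => //; apply: exps_inN.
have zge : exps_ge z (k + s (S (S n))).
  move=> x zx; apply: Rnot_lt_le => xlt; apply: zx.
  by rewrite serEB (yE (S (S n))) ?subrr //; lra.
rewrite (_ : y = S_ (S (S n)) + z)%A; last by rewrite addrC subrK.
rewrite PhiD // /supp serED PhiS (@sum_eval _ _ _ n) ?ltnS //; last first.
  move=> i ni; case: (supp_dec (Phi (e i)) (s (S n))) => // si.
  case: (eP i) => _ [_ [_ /(_ _ si)]].
  by move=> /s_dist []; move=> [/esym].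
case: (supp_dec (Phi z) (s (S n))) => [->|/(gap _ _ _ Gz zge)].
  by rewrite addr0; case: (eP n) => _ [_ []].
by have := s_lt (S n); lra.
Qed.

(** * Continuous linear maps on p-th roots *)

Section LinearMap.
Variable L : (R -> K) -> (R -> K).
Hypothesis hL : cont_linear_root_map p Mhat L.
Variable X : hser K.
Hypothesis lX : locally_fin_cosets X.

Lemma root_map_hser v : locally_fin_cosets v ->
  hcoef (mkser (L v)) = L v /\ locally_fin_cosets (mkser (L v)).
Proof.
move=> lv; have [LM _] := hL.
have [|w <- lw] := proj1 (closureP (L v)); first by apply/LM/closureP; exists v.
by rewrite hcoefK.
Qed.

(* In terms of p-th roots, this is the restriction of L to the line spanned by
   X^{1/p} over the spherically complete field K((t^G)) inside Mhat^{1/p}. *)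
Definition root_map_line (y : hser K) : hser K := mkser (L (y ^+ p * X)%A).
Local Notation Phi := root_map_line.

Lemma line_locally_fin y : exps_in G y -> locally_fin_cosets (y ^+ p * X)%A.
Proof.
by move=> Gy; apply: locally_fin_cosetsM => //; apply/fin_cosets_locally/frob_fin_cosets.
Qed.

Lemma root_map_lineE y : exps_in G y -> hcoef (Phi y) = L (y ^+ p * X)%A.
Proof. by move=> /line_locally_fin /root_map_hser []. Qed.

Lemma root_map_line_fin y : exps_in G y -> locally_fin_cosets (Phi y).
Proof. by move=> /line_locally_fin /root_map_hser []. Qed.

Lemma root_map_lineD y z : exps_in G y -> exps_in G z -> Phi (y + z)%A = (Phi y + Phi z)%A.
Proof.
move=> Gy Gz; have [_ [LD _]] := hL.
have ly := line_locally_fin Gy; have lz := line_locally_fin Gz.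
apply: hser_eq => x; rewrite serED !root_map_lineE //; last exact: exps_inD.
rewrite (frobD hp hchar) mulrDl -[hcoef (_ + _)%A]/(hadd (y ^+ p * X)%A (z ^+ p * X)%A).
by rewrite LD //; apply/closureP; [exists (y ^+ p * X)%A|exists (z ^+ p * X)%A].
Qed.

(** The twisted action by a^p on y^p X is ordinary multiplication of y by a. *)
Lemma root_map_lineZ a y : locally_fin_cosets a -> exps_in G y ->
  Phi (a * y)%A = (a * Phi y)%A.
Proof.
move=> la Gy; have [_ [_ [LZ _]]] := hL.
have ly := line_locally_fin Gy.
apply: hser_eq => x; rewrite root_map_lineE; last by apply: exps_inM => //; case: la.
rewrite -[RHS]/(hmul a (Phi y) x) root_map_lineE // -LZ; first by rewrite exprMn -mulrA -serX.
- by apply/closureP; exists a.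
- by apply/closureP; exists (y ^+ p * X)%A.
Qed.

Lemma root_map0 : L (0%A : hser K) = (0%A : hser K).
Proof.
have [_ [LD _]] := hL.
have l0 : locally_fin_cosets 0%A := fin_cosets_locally (@fin_cosets0 K p G).
have A0 : Mhat (0%A : hser K) by apply/closureP; exists 0%A.
have := LD _ _ A0 A0; rewrite -[hadd _ _]/(hcoef (0 + 0 : hser K)%A) addr0.
have [<- _] := root_map_hser l0; set w := mkser _ => e.
have : w = (w + w)%A by apply: hser_eq => x; rewrite {1}e.
by move=> /eqP; rewrite -subr_eq0 opprD addrA subrr sub0r oppr_eq0 => /eqP ->.
Qed.

Lemma root_map_continuous0 : exists D, forall y, exps_in G y -> exps_ge y D ->
  forall x, supp (Phi y) x -> 0 < x.
Proof.
have [_ [_ [_ Lcont]]] := hL.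
have p0 : 0 < INR p by apply: INRp_gt0; apply: prime_gt0.
have l0 : locally_fin_cosets 0%A := fin_cosets_locally (@fin_cosets0 K p G).
have [||d [d0 hd]] := Lcont (0%A : hser K) _ 1; [by apply/closureP; exists 0%A | lra |].
have [m Xm] := exps_ge_ex X.
(* The bound D solves p D + m = 1 - p ln d, so the p-th root of the norm of y^p X, when nonzero, is
   at most d e^(-1/p) < d. *)
exists ((1 - INR p * ln d - m) / INR p) => y Gy yD.
have zge := exps_geM (exps_geX (n := p) yD) Xm.
set b := _ + m in zge.
have bE : b = 1 - INR p * ln d by rewrite /b; field; lra.
have Ez := root_map_lineE Gy; have lz := line_locally_fin Gy.
move: Ez lz zge; set z := (y ^+ p * X)%A => Ez lz zge.
(* The zero series needs its own case, since [Rpower] is an exponential and never vanishes, not even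
   at base 0. *)
case: (classic (z = 0%A)) => [z0|nz].
  by move=> x; rewrite /supp Ez z0 root_map0 => /(_ erefl).
apply/hnorm_lt; rewrite Ropp_0 exp_0.
have -> : hcoef (Phi y) = hsub (L z) (L (0%A : hser K)).
  by rewrite root_map0 -Ez -[hsub _ _]/(hcoef (Phi y - 0)%A) subr0.
apply: hd; first by apply/closureP; exists z.
rewrite -[hsub _ _]/(hcoef (z - 0)%A) subr0.
have [q zq] := lead_ex nz; rewrite (hnorm_lead zq) /Rpower ln_exp.
rewrite -[X in _ < X](exp_ln _ d0); apply: exp_increasing.
have bq : b <= q by apply: zge; case: zq.
apply: (Rmult_lt_reg_l (INR p)) => //.
by rewrite -Rmult_assoc Rinv_r ?Rmult_1_l; lra.
Qed.

(** Scaling as for normed spaces: a monomial t^c with c in the dense group pG moves the exponents of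
    y beyond D with an excess of at most 1, and Phi commutes with it. *)
Lemma root_map_line_bounded : exists k, forall y m n,
  exps_in G y -> exps_ge y m -> supp (Phi y) n -> m - n <= k.
Proof.
have [D hD] := root_map_continuous0; exists (D + 1) => y m n Gy ym yn.
have [|c [Hc [Dc cD]]] := @pmul_dense p G (prime_gt0 hp) hG hinf (D - m) (D - m + 1); first lra.
have Gc : G c by apply: pmul_sub Hc.
have lc : locally_fin_cosets (mono 1%A c) by apply/fin_cosets_locally/fin_cosets_mono.
have : 0 < n + c; last lra.
apply: (hD (mono 1 c * y)%A).
- by apply: exps_inM => //; apply: exps_in_mono.
- by move=> x /(exps_geM (exps_ge_mono (c := 1%A) (a := c)) ym); lra.
- by rewrite /supp root_map_lineZ // mulmonoE mul1r (_ : n + c - c = n) //; ring.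
Qed.

Lemma root_map_eq0 : L X = hzero K.
Proof.
have e1 := @exps_in1 K G hG.
have := bounded_linear_eq0 root_map_line_fin root_map_lineD root_map_lineZ
  root_map_line_bounded e1.
by move=> /(congr1 (@hcoef K)); rewrite root_map_lineE // expr1n mul1r.
Qed.

End LinearMap.
End Sequence.
End Completion.

Theorem mainTheorem7 (K : fieldType) (p : nat)
  (hp : prime p) (hchar : p \in GRing.pchar K)
  (G : R -> Prop) (hG : add_subgroup G)
  (hinf : ~ exists l : list R, covered_by_cosets (pmul_grp p G) l G) :
  (* (i) *)
  (exists r : nat -> R,
     (forall i, G (r i)) /\ (exists B, forall i, Rabs (r i) <= B) /\
     (forall i j, i <> j -> ~ pmul_grp p G (r i - r j))) /\
  (* (ii) *)
  (forall f : R -> K, compositum p G f ->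
     exists cs : list (R -> K),
       (forall c, In c cs -> hahn (pmul_grp p G) c) /\
       (exists c, In c cs /\ c <> hzero K) /\
       hhorner cs f = hzero K) /\
  (forall f : R -> K, compositum p G f <->
     (hahn G f /\ exists l : list R,
        covered_by_cosets (pmul_grp p G) l (fun x => f x <> GRing.zero))) /\
  (* (iii) *)
  ~ spherically_complete (K:=K) (closure_in G (compositum p G)) /\
  (* (iv) *)
  (forall L : (R -> K) -> (R -> K),
     cont_linear_root_map p (closure_in G (compositum p G)) L ->
     forall x, closure_in G (compositum p G) x -> L x = hzero K).
Proof.
have [s [Gs s01 s_lt s_dist]] := increasing_coset_sequence (prime_gt0 hp) hG hinf.
split.
  exists s; split=> //; split=> //; exists 1 => i.
  by have := s01 i; rewrite /Rabs; case: Rcase_abs; lra.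
split.
  by move=> f /(compositumP hp hchar hG) [Gf _]; apply: hahn_algebraic Gf.
split; first by move=> f; apply: (compositumP hp hchar hG).
split; first exact: (not_spherically_complete hp hchar hG Gs s01 s_lt s_dist).
move=> L hL x /(closureP hp hchar hG) [X <- lX].
exact: (root_map_eq0 hp hchar hG hinf Gs s01 s_lt s_dist hL lX).
Qed.
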